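(* Let $n\ge 1$ and let $\Lambda=(r_0,r_1,\dots,r_n)$ be a sequence of real numbers with $0=r_0<r_1<\cdots<r_n$. For $0<a<1$ let $B^{n,a}_{0},\dots,B^{n,a}_{n}$ be the Chebyshev-Bernstein basis of $\mathrm{span}(1,t^{r_1},\dots,t^{r_n})$ with respect to the interval $[a,1]$, and let $H^n_{0,\Lambda},\dots,H^n_{n,\Lambda}$ be the Gelfond-Bernstein basis of the same space with respect to $[0,1]$. Then for every $k=0,\dots,n$ and every $t\in(0,1]$, $$\lim_{a\to 0^+} B^{n,a}_{k}(t)=H^n_{k,\Lambda}(t).$$
   Context: For $0<a<b$, the Chebyshev-Bernstein basis of $E=\mathrm{span}(1,t^{r_1},\dots,t^{r_n})$ with respect to $[a,b]$ is the basis $(B_0,\dots,B_n)$ of $E$ (functions of $t>0$) characterized by: $\sum_{k=0}^n B_k(t)=1$ for all $t\in[a,b]$, and for each $k=0,\dots,n$ the function $B_k$ has a zero of order exactly $k$ at $a$ and a zero of order exactly $n-k$ at $b$. For pairwise distinct reals $x_0,\dots,x_m$ and a function $f$, the divided difference is $[x_0,\dots,x_m]f=\sum_{i=0}^m \frac{f(x_i)}{\prod_{j\ne i}(x_i-x_j)}$. Put $f_t(x)=t^x$. The Gelfond-Bernstein basis with respect to $[0,1]$ is defined by $H^n_{k,\Lambda}(t)=(-1)^{n-k}\,r_{k+1}\cdots r_n\,[r_k,\dots,r_n]f_t$ for $k=0,\dots,n-1$ and $H^n_{n,\Lambda}(t)=t^{r_n}$. *)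

(* Defs.v *)
From HB Require Import structures.
From mathcomp Require Import all_boot all_order all_algebra.
From mathcomp Require Import all_classical all_reals all_analysis.
Set Implicit Arguments.
Unset Strict Implicit.
Unset Printing Implicit Defensive.
Import Order.TTheory GRing.Theory Num.Theory.
Import numFieldNormedType.Exports.
Local Open Scope classical_set_scope.
Local Open Scope ring_scope.

(* Functions of t > 0 are total functions R -> R whose values at t <= 0 are
   irrelevant: the linear notions below only look at t > 0. *)
Definition span_pos (R : realType) (m : nat) (g : 'I_m -> R -> R) :
    set (R -> R) :=
  [set f | exists c : 'I_m -> R,
     forall t, 0 < t -> f t = \sum_(i < m) c i * g i t].

Definition lin_indep_pos (R : realType) (m : nat) (g : 'I_m -> R -> R) : Prop :=
  forall c : 'I_m -> R,
    (forall t, 0 < t -> \sum_(i < m) c i * g i t = 0) -> forall i, c i = 0.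

Definition basis_pos (R : realType) (m : nat) (E : set (R -> R))
    (g : 'I_m -> R -> R) : Prop :=
  [/\ forall i, E (g i), lin_indep_pos g & E `<=` span_pos g].

(* When r ord0 = 0 the generator of index 0 is the constant 1 on t > 0. *)
Definition muntz_space (R : realType) (n : nat) (r : 'I_n.+1 -> R) :
    set (R -> R) :=
  span_pos (fun (i : 'I_n.+1) (t : R) => t `^ r i).

Definition zero_of_order (R : realType) (f : R -> R) (k : nat) (x : R) : Prop :=
  (forall i, (i < k)%N ->
     (\forall y \near x, derivable (derive1n i f) y 1) /\ derive1n i f x = 0)
  /\ derive1n k f x != 0.

Definition chebyshev_bernstein (R : realType) (n : nat) (r : 'I_n.+1 -> R)
    (a b : R) (B : 'I_n.+1 -> R -> R) : Prop :=
  [/\ basis_pos (muntz_space r) B,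
      forall t, a <= t <= b -> \sum_(k < n.+1) B k t = 1
    & forall k : 'I_n.+1,
        zero_of_order (B k) k a /\ zero_of_order (B k) (n - k) b].

(* The divided difference [x_i : i in A] f, for x injective on A; it does not
   depend on an ordering of the nodes. *)
Definition divided_difference (R : realType) (I : finType) (A : {set I})
    (x : I -> R) (f : R -> R) : R :=
  \sum_(i in A) f (x i) / \prod_(j in A | j != i) (x i - x j).

Definition gelfond_bernstein (R : realType) (n : nat) (r : 'I_n.+1 -> R)
    (k : 'I_n.+1) (t : R) : R :=
  if (k < n)%N then
    (-1) ^+ (n - k) * (\prod_(i < n.+1 | (k < i)%N) r i)
      * divided_difference [set i : 'I_n.+1 | (k <= i)%N]%SET r
          (fun x => t `^ x)
  else t `^ r ord_max.

(* Main.v *)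
Require Import Defs.
From HB Require Import structures.
From mathcomp Require Import all_boot all_order all_algebra.
From mathcomp Require Import all_classical all_reals all_analysis.
From mathcomp Require Import ring lra zify.
Set Implicit Arguments.
Unset Strict Implicit.
Unset Printing Implicit Defensive.
Import Order.TTheory GRing.Theory Num.Theory.
Import numFieldNormedType.Exports.
Local Open Scope classical_set_scope.
Local Open Scope ring_scope.

(** Write [B_k(t) = sum_l c_l t^(r_l)].  The zeros of [B_k] at [a] and at [1] say
    that [sum_l c_l a^(r_l) p(r_l) = 0] for all polynomials [p] of degree [< k]
    and [sum_l c_l p(r_l) = 0] for those of degree [< n-k].  Testing the first
    relations on the Lagrange basis at [r_0, ..., r_(k-1)] gives
    [c_j = - sum_(l >= k) a^(r_l - r_j) L_j(r_l) c_l] for [j < k]; testing the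
    second ones on the Lagrange basis at [r_k, ..., r_n], which has degree
    [n-k], gives [c_l = d w_l + O(|c_0| + ... + |c_(k-1)|)] for [l >= k], where
    [d = sum_l c_l r_l^(n-k)] and the [w_l] are the divided difference weights.
    So if [d] tends to [D] as [a -> 0], then [c_l] tends to [D w_l] for
    [l >= k] and to [0] for [l < k].  By downward induction on [k], [D] is found
    by testing [sum_k B_k = 1] on [p = prod_(i > k) (X - r_i)]: the [B_j] with
    [j < k] contribute [0], [B_k] contributes [d], and those with [j > k]
    contribute [o(1)] because their coefficients of index [<= k] vanish in the
    limit; hence [D = p(0) = prod_(i > k) (- r_i)]. *)

(** * Zeros of sums of real powers as linear relations on the coefficients *)

Lemma near_eq_derive1n (R : realType) (f g : R -> R) (x : R) (i : nat) :
  (\forall y \near x, f y = g y) ->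
  \forall y \near x, derive1n i f y = derive1n i g y.
Proof.
move=> fg; elim: i => [//|i IH].
rewrite !derive1nS; apply: filterS (near_join IH) => y fgy.
by rewrite !derive1E; apply: near_eq_derive => //; rewrite oner_eq0.
Qed.

(** The factor that [i] derivatives of [t ^ x] produce: x (x - 1) ... (x - i + 1), as a polynomial
    in the exponent. *)
Definition falling_poly (R : nzRingType) (i : nat) : {poly R} :=
  \prod_(q < i) ('X - (q%:R)%:P).

Lemma size_falling_poly (R : comNzRingType) i : size (falling_poly R i) = i.+1.
Proof. by rewrite /falling_poly size_prod_XsubC /index_enum -enumT size_enum_ord. Qed.

Lemma derive1n_powR_sum (R : realType) (m : nat) (r c : 'I_m -> R) (i : nat) (y : R) :
  0 < y ->
  derive1n i (fun t => \sum_(l < m) c l * t `^ r l) y =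
  \sum_(l < m) c l * (falling_poly R i).[r l] * y `^ (r l - i%:R).
Proof.
elim: i y => [|i IH] y y0.
  rewrite derive1n0; apply: eq_bigr => l _.
  by rewrite /falling_poly big_ord0 hornerE mulr1 subr0.
rewrite derive1nS.
have near_y : \forall z \near y, derive1n i (fun t => \sum_(l < m) c l * t `^ r l) z =
    (\sum_(l < m) (fun z => (c l * (falling_poly R i).[r l]) *: z `^ (r l - i%:R))) z.
  near=> z; rewrite IH; last by near: z; exact: lt_nbhsr.
  by rewrite fct_sumE.
rewrite derive1E (near_eq_derive _ near_y) ?oner_eq0//.
have dy l : is_derive y 1
    (fun z => (c l * (falling_poly R i).[r l]) *: z `^ (r l - i%:R))
    ((c l * (falling_poly R i).[r l]) *:
      ((r l - i%:R) * y `^ (r l - i%:R - 1))).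
  have ? := is_derive1_powR (r l - i%:R) y0.
  by apply: is_deriveZ.
rewrite derive_sum => [|l]; last by have [] := dy l.
apply: eq_bigr => l _; have [_ ->] := dy l.
rewrite /falling_poly big_ord_recr/= hornerM hornerXsubC /GRing.scale/= !mulrA.
by rewrite -natr1 opprD addrA.
Unshelve. all: by end_near.
Qed.

Lemma poly_functional_eq0 (R : idomainType) (m k : nat) (x c : 'I_m -> R)
    (q : nat -> {poly R}) :
  (forall i, q i \is monic) -> (forall i, size (q i) = i.+1) ->
  (forall i, (i < k)%N -> \sum_(l < m) c l * (q i).[x l] = 0) ->
  forall p : {poly R}, (size p <= k)%N -> \sum_(l < m) c l * p.[x l] = 0.
Proof.
move=> qm qs; elim: k => [|k IH] c0 p sp.
  move: sp; rewrite leqn0 size_poly_eq0 => /eqP ->.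
  by rewrite big1// => l _; rewrite horner0 mulr0.
have s1 : (size (p - p`_k *: q k)%R <= k)%N.
  apply/leq_sizeP => j; rewrite leq_eqVlt => /predU1P[<-|kj].
    rewrite coefB coefZ; have /monicP := qm k; rewrite lead_coefE qs/= => ->.
    by rewrite mulr1 subrr.
  rewrite coefB coefZ (nth_default _ (leq_trans sp kj)).
  by rewrite [(q k)`_j]nth_default ?qs// mulr0 subrr.
have -> : p = (p - p`_k *: q k) + p`_k *: q k by rewrite subrK.
transitivity (\sum_(l < m) c l * (p - p`_k *: q k).[x l] +
  p`_k * \sum_(l < m) c l * (q k).[x l]).
  rewrite mulr_sumr -big_split; apply: eq_bigr => l _ /=.
  by rewrite [in LHS]hornerD mulrDr [X in _ + c l * X]hornerZ mulrCA.
rewrite IH//; last by move=> i ik; apply: c0; rewrite ltnS ltnW.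
by rewrite c0// mulr0 addr0.
Qed.

(** Multiplied by [y ^ i], the i-th derivative at [y] pairs the weights [c l * y ^ r l] with the
    falling factorial of degree [i]; these generate every [p] of size at most [k]. *)
Lemma powR_sum_zero (R : realType) (m k : nat) (r c : 'I_m -> R) (f : R -> R)
    (y : R) :
  0 < y -> (\forall t \near y, f t = \sum_(l < m) c l * t `^ r l) ->
  (forall i, (i < k)%N -> derive1n i f y = 0) ->
  forall p : {poly R}, (size p <= k)%N ->
    \sum_(l < m) c l * y `^ r l * p.[r l] = 0.
Proof.
move=> y0 fE f0; apply: (@poly_functional_eq0 _ _ _ _ _ (falling_poly R)).
- by move=> i; rewrite /falling_poly monic_prod_XsubC.
- exact: size_falling_poly.
move=> i /f0; rewrite (nbhs_singleton (near_eq_derive1n i fE)).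
rewrite derive1n_powR_sum// => /(congr1 ( *%R (y `^ i%:R))).
rewrite mulr0 mulr_sumr => H; rewrite -[RHS]H; apply: eq_bigr => l _.
have -> : y `^ r l = y `^ i%:R * y `^ (r l - i%:R).
  by rewrite -powRD ?subrKC// (gt_eqF y0) implybT.
by ring.
Qed.

(** * Lagrange interpolation on a subset of the nodes *)

Lemma size_prod_XsubC_cond (R : nzRingType) (I : finType) (P : pred I) (x : I -> R) :
  size (\prod_(i | P i) ('X - (x i)%:P)) = #|P|.+1.
Proof.
rewrite -big_filter size_prod_XsubC; congr _.+1.
by rewrite size_filter -sum1_count sum1_card.
Qed.

Definition lagrange_basis (F : fieldType) (I : finType) (A : {set I})
    (x : I -> F) (i : I) : {poly F} :=
  (\prod_(j in A | j != i) (x i - x j))^-1 *: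
    \prod_(j in A | j != i) ('X - (x j)%:P).

Lemma horner_lagrange_basis (F : fieldType) (I : finType) (A : {set I})
    (x : I -> F) (i l : I) :
  injective x -> l \in A -> (lagrange_basis A x i).[x l] = (l == i)%:R.
Proof.
move=> xinj lA; rewrite /lagrange_basis hornerZ horner_prod.
under [X in _ * X]eq_bigr do rewrite hornerXsubC.
have [->|li] := eqVneq l i.
  rewrite mulVf// prodf_seq_neq0; apply/allP => j _; apply/implyP => /andP[_ ji].
  by rewrite subr_eq0 (inj_eq xinj) eq_sym.
by rewrite [X in _ * X](bigD1 l) ?lA//= subrr mul0r mulr0.
Qed.

Lemma size_lagrange_basis (F : fieldType) (I : finType) (A : {set I})
    (x : I -> F) (i : I) :
  i \in A -> (size (lagrange_basis A x i) <= #|A|)%N.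
Proof.
move=> iA; apply: leq_trans (size_scale_leq _ _) _.
rewrite size_prod_XsubC_cond (cardsD1 i A) iA add1n ltnS.
by apply/subset_leq_card/fintype.subsetP => j; rewrite !inE !unfold_in andbC.
Qed.

(** This is where the divided difference weights come from. *)
Lemma lead_lagrange_basis (F : fieldType) (I : finType) (A : {set I})
    (x : I -> F) (i : I) :
  i \in A ->
  (lagrange_basis A x i)`_(#|A|.-1) = (\prod_(j in A | j != i) (x i - x j))^-1.
Proof.
move=> iA; rewrite coefZ.
set q := (\prod_(j in A | j != i) ('X - (x j)%:P)).
have /monicP : q \is monic by rewrite monic_prod_XsubC.
rewrite lead_coefE size_prod_XsubC_cond/=.
have -> : #|[pred j | (j \in A) && (j != i)]| = #|A|.-1.
  rewrite (cardsD1 i A) iA add1n/=; apply: eq_card => j.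
  by rewrite !inE !unfold_in andbC.
by move=> ->; rewrite mulr1.
Qed.

(** * Limits of solutions of perturbed linear systems *)

Lemma cvg_sum (R : realType) (I : finType) (T : Type) (F : set_system T)
    {FF : Filter F} (P : pred I) (f : I -> T -> R) (l : I -> R) :
  (forall i, P i -> f i x @[x --> F] --> l i) ->
  \sum_(i | P i) f i x @[x --> F] --> \sum_(i | P i) l i.
Proof. by apply: cvg_big; exact: add_continuous. Qed.

(** No bound on [c] is assumed: once the entries of [E] sum to at most 1/2, the system itself bounds
    [c], so the error [E c] tends to 0 and [c] follows [b]. *)
Lemma cvg_near_fixpoint (R : realType) (I : finType) (T : Type)
    (F : set_system T) {FF : ProperFilter F} (c b : I -> T -> R)
    (E : I -> I -> T -> R) (beta : I -> R) :
  (\forall a \near F, forall i, c i a = b i a + \sum_l E i l a * c l a) ->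
  (forall i, b i a @[a --> F] --> beta i) ->
  (forall i l, E i l a @[a --> F] --> 0) ->
  forall i, c i a @[a --> F] --> beta i.
Proof.
move=> cE cvb cvE.
(* The added 1 puts [C] strictly above the limit of the norms of [b]. *)
pose C : R := \sum_i `|beta i| + 1.
have bC : \forall a \near F, \sum_i `|b i a| <= C.
  apply: (@cvgr_le _ _ _ _ _ (\sum_i `|beta i|)); last by rewrite ltrDl.
  by apply: cvg_sum => i _; apply: cvg_norm; exact: cvb.
have E2 : \forall a \near F, \sum_i \sum_l `|E i l a| <= 2^-1.
  apply: (@cvgr_le _ _ _ _ _ 0); last by rewrite invr_gt0.
  rewrite -[X in _ --> X](_ : \sum_(i : I) \sum_(l : I) (0 : R) = 0).
    apply: cvg_sum => i _; apply: cvg_sum => l _; rewrite -[X in _ --> X](@normr0 _ R).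
    by apply: cvg_norm; exact: cvE.
  by rewrite big1// => i _; rewrite big1.
have cC : \forall a \near F, forall l, `|c l a| <= 2 * C.
  near=> a => l.
  pose S := \sum_i `|c i a|.
  have cS j : `|c j a| <= S by rewrite /S (bigD1 j)//= lerDl sumr_ge0.
  apply: le_trans (cS l) _.
  suff : S <= C + 2^-1 * S by lra.
  have S0 : 0 <= S by rewrite sumr_ge0.
  have bCa : \sum_i `|b i a| <= C by near: a.
  have E2a : \sum_i \sum_l `|E i l a| <= 2^-1 by near: a.
  apply: (@le_trans _ _ (\sum_i `|b i a| + (\sum_i \sum_l `|E i l a|) * S)).
    rewrite mulr_suml -big_split/= /S; apply: ler_sum => i _.
    have -> : c i a = b i a + \sum_l E i l a * c l a by move: i; near: a.
    apply: le_trans (ler_normD _ _) _; rewrite lerD2l mulr_suml.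
    apply: le_trans (ler_norm_sum _ _ _) _.
    by apply: ler_sum => j _; rewrite normrM ler_wpM2l.
  by rewrite lerD// ler_wpM2r.
move=> i; rewrite -[beta i]addr0.
apply: (@cvg_trans _ ((b i a + \sum_l E i l a * c l a) @[a --> F])).
  by apply: near_eq_cvg; apply: filterS cE => a ->.
apply: cvgD; first exact: cvb.
rewrite -[X in _ --> X](_ : \sum_(l : I) (0 : R) = 0); last by rewrite big1.
apply: cvg_sum => l _; apply: norm_cvg0.
apply: (@squeeze_cvgr _ _ _ _ (fun=> 0) (fun a => `|E i l a| * (2 * C))).
- apply: filterS cC => a /(_ l) ca.
  by rewrite normr_ge0 normrM ler_wpM2l.
- exact: cvg_cst.
rewrite -[X in _ --> X](_ : `|0 : R| * (2 * C) = 0); last by rewrite normr0 mul0r.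
by apply: cvgMl; apply: cvg_norm; exact: cvE.
Unshelve. all: by end_near.
Qed.

(** * Coefficient relations for the Chebyshev-Bernstein basis *)

Lemma derive1n_cst0 (R : realType) (i : nat) (y : R) :
  derive1n i (fun=> 0 : R) y = 0.
Proof.
by elim: i y => [//|i IH] y; rewrite derive1nS (funext IH) derive1_cst.
Qed.

(** All derivatives vanish at [y], so every polynomial of size at most [m] may be tested; the
    Lagrange polynomial at [r l] isolates [c l * y ^ r l]. *)
Lemma powR_sum_eq0 (R : realType) (m : nat) (r c : 'I_m -> R) (y : R) :
  injective r -> 0 < y -> (\forall t \near y, \sum_(l < m) c l * t `^ r l = 0) ->
  forall l, c l = 0.
Proof.
move=> rinj y0 c0 l.
have H : \forall t \near y, (fun=> 0) t = \sum_(l < m) c l * t `^ r l.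
  by apply: filterS c0 => t ->.
have := powR_sum_zero y0 H (k := m) (fun i _ => derive1n_cst0 i y)
  (p := lagrange_basis [set: 'I_m]%SET r l).
rewrite -[X in (_ <= X)%N]card_ord -cardsT size_lagrange_basis ?inE// => /(_ isT).
rewrite (bigD1 l)//= horner_lagrange_basis ?inE// eqxx mulr1 big1 ?addr0.
  by move/eqP; rewrite mulf_eq0 [X in _ || X](gt_eqF (powR_gt0 _ y0)) orbF => /eqP.
by move=> j /negbTE jl; rewrite horner_lagrange_basis ?inE// jl mulr0.
Qed.

Definition endpoint_expansion (R : realType) (n : nat) (r : 'I_n.+1 -> R)
    (a : R) (B : 'I_n.+1 -> R -> R) (c : 'I_n.+1 -> 'I_n.+1 -> R) : Prop :=
  [/\ forall k t, 0 < t -> B k t = \sum_l c k l * t `^ r l,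
      forall (k : 'I_n.+1) (p : {poly R}), (size p <= k)%N ->
        \sum_l c k l * a `^ r l * p.[r l] = 0,
      forall (k : 'I_n.+1) (p : {poly R}), (size p <= n - k)%N ->
        \sum_l c k l * p.[r l] = 0
    & forall l, \sum_k c k l = (l == ord0)%:R].

Lemma chebyshev_bernstein_expansion (R : realType) (n : nat)
    (r : 'I_n.+1 -> R) (a : R) (B : 'I_n.+1 -> R -> R) :
  injective r -> r ord0 = 0 -> 0 < a < 1 -> chebyshev_bernstein r a 1 B ->
  exists c, endpoint_expansion r a B c.
Proof.
move=> rinj r0 /andP[a0 a1] [[BE _ _] B1 Bz].
have [c cB] := @choice _ _ (fun k c => forall t, 0 < t ->
  B k t = \sum_l c l * t `^ r l) BE.
have nearB (x : R) k : 0 < x -> \forall t \near x, B k t = \sum_l c k l * t `^ r l.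
  by move=> x0; near=> t; apply: cB; near: t; exact: lt_nbhsr.
exists c; split=> //.
- move=> k p; apply: (powR_sum_zero a0 (nearB a k a0)) => i ik.
  by have [[za _] _] := Bz k; have [] := za _ ik.
- move=> k p sp.
  have := @powR_sum_zero _ _ (n - k) _ _ _ _ ltr01 (nearB 1 k ltr01) _ p sp.
  rewrite powR1; under eq_bigr do rewrite mulr1; apply => i ik.
  by have [_ [z1 _]] := Bz k; have [] := z1 _ ik.
move=> l; apply/eqP; rewrite -subr_eq0; apply/eqP; move: l.
(* The sum equals 1 on [a, 1] only; the midpoint has a whole neighbourhood inside that interval. *)
pose y := (a + 1) / 2.
apply: (@powR_sum_eq0 _ _ _ _ y rinj); first by rewrite /y; lra.
near=> t.
have at1 : a < t < 1.
  apply/andP; split; near: t.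
    by apply: lt_nbhsr; rewrite /y; lra.
  by apply: lt_nbhsl; rewrite /y; lra.
have t0 : 0 < t by lra.
under eq_bigr do rewrite mulrBl; rewrite sumrB.
have -> : \sum_(l < n.+1) (l == ord0)%:R * t `^ r l = 1.
  rewrite (bigD1 ord0)//= r0 powRr0 mulr1 big1 ?addr0// => j /negbTE ->.
  by rewrite mul0r.
under eq_bigr do rewrite mulr_suml.
rewrite exchange_big/=; under eq_bigr do rewrite -cB//.
by rewrite B1 ?subrr//; lra.
Unshelve. all: by end_near.
Qed.

(** * Convergence of the coefficients of one basis function *)

Lemma sum_lagrange_basis (F : fieldType) (I : finType) (A : {set I})
    (x c : I -> F) (i : I) :
  injective x -> i \in A ->
  \sum_l c l * (lagrange_basis A x i).[x l] =
  c i + \sum_(l in ~: A) c l * (lagrange_basis A x i).[x l].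
Proof.
move=> xinj iA; rewrite (bigID (mem A))/=; congr (_ + _).
  rewrite (bigD1 i)//= horner_lagrange_basis// eqxx mulr1 big1 ?addr0//.
  by move=> j /andP[jA /negbTE ji]; rewrite horner_lagrange_basis// ji mulr0.
by apply: eq_bigl => j; rewrite inE.
Qed.

(** A functional that kills all degrees below [k] sees only the coefficient of degree [k]. *)
Lemma poly_functional_coef (F : idomainType) (m k : nat) (x c : 'I_m -> F) :
  (forall p : {poly F}, (size p <= k)%N -> \sum_l c l * p.[x l] = 0) ->
  forall p : {poly F}, (size p <= k.+1)%N ->
    \sum_l c l * p.[x l] = p`_k * \sum_l c l * x l ^+ k.
Proof.
move=> c0 p sp; apply/eqP; rewrite -subr_eq0 mulr_sumr -sumrB; apply/eqP.
rewrite -[RHS](c0 (p - p`_k *: 'X^k)).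
  by apply: eq_bigr => l _; rewrite hornerD hornerN hornerZ hornerXn; ring.
apply/leq_sizeP => j; rewrite coefB coefZ coefXn leq_eqVlt.
case/predU1P => [<-|kj]; first by rewrite eqxx mulr1 subrr.
by rewrite (nth_default _ (leq_trans sp kj)) gtn_eqF// mulr0 subrr.
Qed.

Lemma coef_cvg (R : realType) (n : nat) (r : 'I_n.+1 -> R) (k : 'I_n.+1)
    (c : R -> 'I_n.+1 -> R) (D : R) :
  (forall i j : 'I_n.+1, (i < j)%N -> r i < r j) -> injective r ->
  (\forall a \near 0^'+, forall p : {poly R}, (size p <= k)%N ->
     \sum_l c a l * a `^ r l * p.[r l] = 0) ->
  (\forall a \near 0^'+, forall p : {poly R}, (size p <= n - k)%N ->
     \sum_l c a l * p.[r l] = 0) ->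
  \sum_l c a l * r l ^+ (n - k) @[a --> 0^'+] --> D ->
  forall l, c a l @[a --> 0^'+] -->
    if (k <= l)%N then
      D * (\prod_(j in [set i : 'I_n.+1 | (k <= i)%N]%SET | j != l) (r l - r j))^-1
    else 0.
Proof.
move=> r_incr rinj ca0 c10 cD.
set U := [set i : 'I_n.+1 | (k <= i)%N]%SET.
have cardCU : #|~: U| = k.
  rewrite -sum1_card -[RHS]card_ord -[RHS]sum1_card (big_ord_widen n.+1 (fun=> 1%N)) 1?ltnW//.
  by apply: eq_bigl => i; rewrite !inE -ltnNge.
have cardU : #|U| = (n - k).+1.
  by have := cardsC U; rewrite card_ord cardCU; have := ltn_ord k; lia.
set w := fun l => (\prod_(j in U | j != l) (r l - r j))^-1.
pose d a := \sum_l c a l * r l ^+ (n - k).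
(* The relation at [a] for the Lagrange polynomial of [j < k], divided by [a ^ r j], reads
   [c_j = sum_(l in U) e j l a * c_l]. *)
pose e (j l : 'I_n.+1) a :=
  - (a `^ (r l - r j) * (lagrange_basis (~: U) r j).[r l]).
(* In the rows of [U] the low coefficients are eliminated through [e]: left in place they would have
   the constant factors [L_i(r_j)], which do not tend to 0. *)
pose E (i l : 'I_n.+1) a :=
  if l \in U then
    if i \in U then - \sum_(j in ~: U) (lagrange_basis U r i).[r j] * e j l a
    else e i l a
  else 0.
apply: (@cvg_near_fixpoint _ _ _ _ _ (fun l a => c a l)
   (fun i a => if (k <= i)%N then d a * w i else 0) E).
- near=> a => i.
  have a0 : 0 < a by near: a; exact: nbhs_right_gt.
  have c0a : forall p : {poly R}, (size p <= k)%N ->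
     \sum_l c a l * a `^ r l * p.[r l] = 0 by near: a.
  have c0b : forall p : {poly R}, (size p <= n - k)%N ->
     \sum_l c a l * p.[r l] = 0 by near: a.
  have cL j : j \in ~: U -> c a j = \sum_(l in U) e j l a * c a l.
    move=> jU; have := c0a (lagrange_basis (~: U) r j).
    rewrite -[X in (_ <= X)%N]cardCU size_lagrange_basis// => /(_ isT).
    rewrite sum_lagrange_basis// finset.setCK => /eqP; rewrite addr_eq0 => /eqP H.
    have apos : a `^ r j != 0 by rewrite gt_eqF// powR_gt0.
    apply: (mulIf apos); rewrite H mulr_suml -sumrN; apply: eq_bigr => l _.
    rewrite /e powRB ?(gt_eqF a0) ?implybT//.
    by field.
  have -> : \sum_l E i l a * c a l = \sum_(l in U) (if i \in U then
      - \sum_(j in ~: U) (lagrange_basis U r i).[r j] * e j l a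
      else e i l a) * c a l.
    rewrite [RHS]big_mkcond; apply: eq_bigr => l _; rewrite /E.
    by case: ifP => // _; rewrite mul0r.
  have [iU|iU] := boolP (i \in U); last first.
    have /negbTE -> : ~~ (k <= i)%N by move: iU; rewrite inE.
    by rewrite add0r cL// inE.
  have -> : (k <= i)%N by move: iU; rewrite inE.
  (* This Lagrange polynomial has degree at most [n - k], one more than the relations at 1 kill, so
     its pairing is its coefficient [w i] times [d a]. *)
  have := poly_functional_coef c0b (p := lagrange_basis U r i).
  rewrite -cardU size_lagrange_basis// => /(_ isT).
  rewrite -[X in _`_X]/(n - k).+1.-1 -cardU lead_lagrange_basis//.
  rewrite sum_lagrange_basis// mulrC => /eqP; rewrite eq_sym -subr_eq => /eqP <-.
  congr (_ + _).
  under [RHS]eq_bigr do rewrite mulNr mulr_suml.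
  rewrite sumrN; congr (- _); rewrite exchange_big; apply: eq_bigr => j jU.
  by rewrite cL// mulr_suml; apply: eq_bigr => l _; ring.
- move=> i; case: (k <= i)%N; last exact: cvg_cst.
  by apply: cvgMl.
move=> i l; rewrite /E.
have [lU|lU] := boolP (l \in U); last exact: cvg_cst.
have ecvg j : j \in ~: U -> e j l a @[a --> 0^'+] --> 0.
  move=> jU; rewrite -[X in _ --> X](@oppr0 R); apply: cvgN.
  rewrite -[X in _ --> X](mul0r (lagrange_basis (~: U) r j).[r l]).
  (* Since [j < k <= l], the exponent is positive. *)
  apply: cvgMl; apply: powR_cvg0; rewrite subr_gt0 r_incr//.
  by move: jU lU; rewrite !inE -ltnNge; exact: leq_trans.
have [iU|iU] := boolP (i \in U); last by apply: ecvg; rewrite inE.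
rewrite -[X in _ --> X](@oppr0 R); apply: cvgN.
rewrite -[X in _ --> X](_ : \sum_(j in ~: U) (0 : R) = 0); last by rewrite big1.
apply: cvg_sum => j jU; rewrite -[X in _ --> X](mulr0 (lagrange_basis U r i).[r j]).
by apply: cvgMr; exact: ecvg.
Unshelve. all: by end_near.
Qed.

(** * The Gelfond-Bernstein coefficients and the passage to the limit *)

Lemma card_ord_gt (n : nat) (k : 'I_n.+1) :
  #|[pred i : 'I_n.+1 | (k < i)%N]| = (n - k)%N.
Proof.
have := cardC [pred i : 'I_n.+1 | (k < i)%N].
have -> : #|[predC [pred i : 'I_n.+1 | (k < i)%N]]| = k.+1.
  rewrite -sum1_card -[RHS]card_ord -[RHS]sum1_card.
  rewrite (big_ord_widen n.+1 (fun=> 1%N))//.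
  by apply: eq_bigl => i; rewrite !inE -leqNgt ltnS.
by rewrite card_ord => /(canRL (addnK _)); rewrite subSS.
Qed.

(** The sign is absorbed into the factors [- r i]. For [k = n] both products are empty, so the
    separate case of the definition fits the same formula. *)
Lemma gelfond_bernsteinE (R : realType) (n : nat) (r : 'I_n.+1 -> R)
    (k : 'I_n.+1) (t : R) :
  gelfond_bernstein r k t = \sum_(l : 'I_n.+1 | (k <= l)%N)
    ((\prod_(i : 'I_n.+1 | (k < i)%N) (- r i)) *
    (\prod_(j in [set i : 'I_n.+1 | (k <= i)%N]%SET | j != l) (r l - r j))^-1)
    * t `^ r l.
Proof.
rewrite /gelfond_bernstein; case: ltnP => kn.
  rewrite prodrN card_ord_gt /divided_difference mulr_sumr.
  by apply: eq_big => [l|l _]; [rewrite inE|ring].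
have -> : k = ord_max by apply/val_inj/eqP; rewrite /= eqn_leq kn -ltnS ltn_ord.
have leE (i : 'I_n.+1) : (n <= i)%N = (i == ord_max).
  by rewrite -val_eqE/= eqn_leq leq_ord.
rewrite (big_pred1 ord_max)//= !big_pred0 ?invr1 ?mul1r// => i.
  by rewrite inE/= leE andbN.
by rewrite /= ltnNge leq_ord.
Qed.

Theorem theorem4 (R : realType) (n : nat) (r : 'I_n.+1 -> R)
    (B : R -> 'I_n.+1 -> R -> R)
    (n_ge1 : (1 <= n)%N)
    (r0 : r ord0 = 0)
    (r_incr : forall i j : 'I_n.+1, (i < j)%N -> r i < r j)
    (HB : forall a : R, 0 < a < 1 -> chebyshev_bernstein r a 1 (B a)) :
  forall (k : 'I_n.+1) (t : R), 0 < t <= 1 ->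
    B a k t @[a --> 0^'+] --> gelfond_bernstein r k t.
Proof.
have rinj : injective r.
  move=> i j rij; have [ij|ji|/val_inj//] := ltngtP i j.
    by have := r_incr _ _ ij; rewrite rij ltxx.
  by have := r_incr _ _ ji; rewrite rij ltxx.
have /choice[c cP] : forall a, exists c,
    0 < a < 1 -> endpoint_expansion r a (B a) c.
  move=> a; have [a01|na01] := boolP (0 < a < 1); last by exists (fun _ _ => 0).
  have [c ca] := chebyshev_bernstein_expansion rinj r0 a01 (HB _ a01).
  by exists c.
have near01 : \forall a \near (0:R)^'+, 0 < a < 1.
  near=> a; apply/andP; split; first by near: a; exact: nbhs_right_gt.
  by near: a; exact: nbhs_right_lt.
pose D (k : 'I_n.+1) := \prod_(i : 'I_n.+1 | (k < i)%N) (- r i).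
have cvgc (k : 'I_n.+1) : forall l, c a k l @[a --> 0^'+] -->
    if (k <= l)%N then
      D k * (\prod_(j in [set i : 'I_n.+1 | (k <= i)%N]%SET | j != l) (r l - r j))^-1
    else 0.
  (* Strong induction on [n - k], so the limits for all rows [j > k] are available. *)
  have [m] := ubnP (n - k); elim: m k => // m IH k km.
  apply: coef_cvg => //.
  - by apply: filterS near01 => a /cP[_ + _ _]; exact.
  - by apply: filterS near01 => a /cP[_ _ + _]; exact.
  pose p : {poly R} := \prod_(i : 'I_n.+1 | (k < i)%N) ('X - (r i)%:P).
  have sp : size p = (n - k).+1 by rewrite size_prod_XsubC_cond card_ord_gt.
  have p1 : p`_(n - k) = 1.
    have /monicP : p \is monic by rewrite monic_prod_XsubC.
    by rewrite lead_coefE sp.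
  have pr0 (l : 'I_n.+1) : (k < l)%N -> p.[r l] = 0.
    by move=> kl; rewrite horner_prod (bigD1 l)//= hornerXsubC subrr mul0r.
  rewrite -[D k]subr0.
  apply: (@cvg_trans _ ((D k - \sum_(j : 'I_n.+1 | (k < j)%N)
      \sum_l c a j l * p.[r l]) @[a --> 0^'+])).
    apply: near_eq_cvg; apply: filterS near01 => a /cP[_ _ c1 cs].
    (* Summed over the rows, only the constant term survives, and it contributes [p(0)] because
       [r_0 = 0]. *)
    have : \sum_j \sum_l c a j l * p.[r l] = D k.
      rewrite exchange_big/=; under eq_bigr do rewrite -mulr_suml cs.
      rewrite (bigD1 ord0)//= r0 mul1r big1 ?addr0.
        rewrite horner_prod; apply: eq_bigr => i _.
        by rewrite hornerXsubC sub0r.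
      by move=> j /negbTE ->; rewrite mul0r.
    move=> <-; rewrite (bigID (fun j : 'I_n.+1 => (k < j)%N))/= addrAC subrr add0r.
    rewrite (bigD1 k) ?ltnn//= [X in _ + X]big1 ?addr0.
      by rewrite (poly_functional_coef (c1 k)) ?sp// p1 mul1r.
    (* For [j < k] the degree [n - k] of [p] is below [n - j], so the relations at 1 annihilate row
       [j]. *)
    move=> j /andP[]; rewrite -leqNgt -val_eqE/= => jk kj; apply: c1.
    by rewrite sp; have := ltn_ord k; lia.
  apply: cvgB; first exact: cvg_cst.
  rewrite -[X in _ --> X](_ : \sum_(j : 'I_n.+1 | (k < j)%N)
      \sum_(l : 'I_n.+1) (0 : R) = 0); last by rewrite big1// => j _; rewrite big1.
  apply: cvg_sum => j kj; apply: cvg_sum => l _.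
  (* If [l >= j > k] then [r l] is a root of [p]; if [l < j] the coefficient tends to 0 by
     induction. *)
  have [jl|lj] := leqP j l.
    rewrite pr0 ?(leq_trans kj)//; under eq_cvg do rewrite mulr0.
    exact: cvg_cst.
  rewrite -[X in _ --> X](mul0r p.[r l]); apply: cvgMl.
  have := IH j _ l; rewrite [(j <= l)%N]leqNgt lj/=; apply.
  by have := ltn_ord j; lia.
move=> k t /andP[t0 _]; rewrite gelfond_bernsteinE.
apply: (@cvg_trans _ ((\sum_l c a k l * t `^ r l) @[a --> 0^'+])).
  by apply: near_eq_cvg; apply: filterS near01 => a /cP[BE _ _ _]; rewrite BE.
rewrite big_mkcond/=; apply: cvg_sum => l _.
have := cvgc k l; case: (k <= l)%N => cl; first exact: cvgMl.
by rewrite -[X in _ --> X](mul0r (t `^ r l)); apply: cvgMl.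
Unshelve. all: by end_near.
Qed.
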